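(* Let $\theta=\{\theta_t\}_{t\in\mathbb{Z}}$ be a persistent function on a persistence group $\mathcal{G}:(\mathbb{Z},\leq)\to\mathbf{Grp}$, let $s\leq t$, and let $\varrho_s\in\widehat{\mathcal{G}}_s$ be an irreducible representation. If the persistent representation $\varrho_{s,t}$ is nonzero, then the persistent Fourier transform $\widehat\theta_{s,t}(\varrho_s)$ has the same spectrum as the classical Fourier transform $\widehat\theta_s(\varrho_s)$. That is, $$\mathrm{Spec}_{s,t}(\theta)(\varrho_s)=\mathrm{Spec}_s(\theta)(\varrho_s),$$ where $\mathrm{Spec}_s(\theta)(\varrho_s)=\|\widehat\theta_s(\varrho_s)\|$.
   Context: A persistence group is a functor $\mathcal{G}:(\mathbb{Z},\leq)\to\mathbf{Grp}$, here with finite groups $\mathcal{G}_t$ and structure homomorphisms $\phi_{s,t}:\mathcal{G}_s\to\mathcal{G}_t$ for $s\leq t$. A persistent function on $\mathcal{G}$ is a family of functions $\theta_t:\mathcal{G}_t\to\mathbb{C}$ with $\theta_s=\theta_t\circ\phi_{s,t}$ for all $s\leq t$. Representations are complex; $\widehat{\mathcal{G}}_s$ is the set of equivalence classes of irreducible representations of $\mathcal{G}_s$. Let $\rho_t$ be the left regular representation of $\mathcal{G}_t$ on $\mathbb{C}[\mathcal{G}_t]$ and let $f_{s,t}:\mathbb{C}[\mathcal{G}_s]\to\mathbb{C}[\mathcal{G}_t]$ be the linear extension of $\phi_{s,t}$. Realize $\varrho_s\in\widehat{\mathcal{G}}_s$ as a subrepresentation $W_s\subseteq\mathbb{C}[\mathcal{G}_s]$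 of the regular representation. The persistent representation $\varrho_{s,t}$ is the representation of $\mathcal{G}_s$ on $W_{s,t}=f_{s,t}(W_s)$ given by $\varrho_{s,t}(g)(v)=\rho_t(\phi_{s,t}(g))(v)$. The classical and the $(s,t)$-persistent Fourier transforms are $$\widehat\theta_s(\varrho_s)=\sum_{g\in\mathcal{G}_s}\theta_s(g)\,\varrho_s(g^{-1})\in\mathrm{End}(W_s),\qquad \widehat\theta_{s,t}(\varrho_s)=\sum_{g\in\mathcal{G}_s}\theta_s(g)\,\varrho_{s,t}(g^{-1})\in\mathrm{End}(W_{s,t}).$$ The $(s,t)$-persistent Fourier spectrum of $\theta$ is the function $\mathrm{Spec}_{s,t}(\theta):\widehat{\mathcal{G}}_s\to\mathbb{R}_{\geq 0}$, $\varrho_s\mapsto\|\widehat\theta_{s,t}(\varrho_s)\|$, where $\|\cdot\|$ denotes a chosen matrix norm, such as the Hilbert–Schmidt norm ($\|A\|_{\mathrm{HS}}^2=\mathrm{tr}(A^\dagger A)$). *)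

(* Defs.v *)
From HB Require Import structures.
From mathcomp Require Import all_boot all_order all_algebra all_fingroup.
From mathcomp Require Import spectral sesquilinear reals complex.

Set Implicit Arguments.
Unset Strict Implicit.
Unset Printing Implicit Defensive.

Import Order.TTheory GRing.Theory Num.Theory.

Local Open Scope ring_scope.
Local Open Scope sesquilinear_scope.

Record persistenceGroup := PersistenceGroup {
  pg_obj :> int -> finGroupType;
  pg_map : forall s t : int, s <= t -> {multiplicative pg_obj s -> pg_obj t};
  pg_map_id : forall (s : int) (ss : s <= s), pg_map ss =1 id;
  pg_map_comp : forall (r s t : int) (rs : r <= s) (st : s <= t) (rt : r <= t),
    pg_map rt =1 pg_map st \o pg_map rs
}.

Arguments pg_map G {s t} st : rename.

Section GroupAlgebra.
Variable C : numClosedFieldType.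

Definition grpAlg (gT : finGroupType) : vectType C := {ffun gT -> C^o}.

Definition cinner (gT : finGroupType) (u v : grpAlg gT) : C :=
  \sum_(x : gT) u x * (v x)^*.

(* g sends the basis vector e_h to e_(g h), so the coefficient of e_h in the
   image of v is the coefficient of e_(g^-1 h) in v. *)
Definition lreg_fun (gT : finGroupType) (g : gT) (v : grpAlg gT) : grpAlg gT :=
  [ffun h => v (g^-1 * h)%g].

Definition lreg (gT : finGroupType) (g : gT) : 'End(grpAlg gT) :=
  linfun (lreg_fun g).

Definition alg_ext_fun (gT hT : finGroupType) (phi : gT -> hT)
    (v : grpAlg gT) : grpAlg hT :=
  [ffun k => \sum_(h : gT | phi h == k) v h].

Definition alg_ext (gT hT : finGroupType) (phi : gT -> hT) :
    'Hom(grpAlg gT, grpAlg hT) :=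
  linfun (alg_ext_fun phi).

Lemma lregE (gT : finGroupType) (g : gT) v h : lreg g v h = v (g^-1 * h)%g.
Proof.
have lin : linear (lreg_fun g) by move=> a u w; apply/ffunP => x; rewrite !ffunE.
pose f : {linear grpAlg gT -> grpAlg gT} :=
  HB.pack (lreg_fun g) (GRing.isLinear.Build _ _ _ _ _ lin).
by rewrite /lreg (lfunE f) /= ffunE.
Qed.

Lemma alg_extE (gT hT : finGroupType) (phi : gT -> hT) v k :
  alg_ext phi v k = \sum_(h : gT | phi h == k) v h.
Proof.
have lin : linear (alg_ext_fun phi).
  move=> a u w; apply/ffunP => x; rewrite !ffunE scaler_sumr -big_split /=.
  by apply: eq_bigr => i _; rewrite !ffunE.
pose f : {linear grpAlg gT -> grpAlg hT} :=
  HB.pack (alg_ext_fun phi) (GRing.isLinear.Build _ _ _ _ _ lin).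
by rewrite /alg_ext (lfunE f) /= ffunE.
Qed.

Definition lreg_stable (gT : finGroupType) (W : {vspace grpAlg gT}) : Prop :=
  forall g : gT, (lreg g @: W <= W)%VS.

Definition irreducible_subrep (gT : finGroupType) (W : {vspace grpAlg gT}) :
    Prop :=
  [/\ W != 0%VS, lreg_stable W &
      forall U : {vspace grpAlg gT},
        (U <= W)%VS -> lreg_stable U -> U = 0%VS \/ U = W].

(* The restriction of A to W, when W is stable under A (see restr_endE). *)
Definition restr_end (V : vectType C) (W : {vspace V}) (A : 'End(V)) :
    'End(subvs_of W) :=
  linfun (fun w : subvs_of W => vsproj W (A (vsval w))).

Lemma restr_endE (V : vectType C) (W : {vspace V}) (A : 'End(V)) w :
  (A @: W <= W)%VS -> vsval (restr_end W A w) = A (vsval w).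
Proof.
move=> AW; rewrite /restr_end (lfunE (vsproj W \o A \o @vsval _ _ W)) /=.
by rewrite vsprojK //; apply: (subvP AW); apply/memv_img/subvsP.
Qed.

Definition fourier_at (gT : finGroupType) (V : vectType C) (theta : gT -> C)
    (rho : gT -> 'End(V)) : 'End(V) :=
  \sum_(g : gT) theta g *: rho (g^-1)%g.

(* The j-th column holds the coordinates of A (B_j) in the basis B. *)
Definition mx_end (V : vectType C) (n : nat) (B : n.-tuple V) (A : 'End(V)) :
    'M[C]_n :=
  \matrix_(i < n, j < n) coord B i (A (tnth B j)).

(* Orthonormal basis of W for the inner product of C[G] making the group
   elements orthonormal. *)
Definition orthonormal_basis (gT : finGroupType) (W : {vspace grpAlg gT})
    (n : nat) (B : n.-tuple (subvs_of W)) : Prop :=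
  basis_of fullv B /\
  forall i j : 'I_n,
    cinner (vsval (tnth B i)) (vsval (tnth B j)) = (i == j)%:R.

End GroupAlgebra.

Section Persistent.
Variables (C : numClosedFieldType) (G : persistenceGroup).

Definition persistent_function (theta : forall t : int, G t -> C) : Prop :=
  forall (s t : int) (st : s <= t) (x : G s), theta s x = theta t (pg_map G st x).

Definition rep (s : int) (W : {vspace grpAlg C (G s)}) (g : G s) :
    'End(subvs_of W) :=
  restr_end W (lreg C g).

Definition pspace (s t : int) (st : s <= t) (W : {vspace grpAlg C (G s)}) :
    {vspace grpAlg C (G t)} :=
  (alg_ext C (pg_map G st) @: W)%VS.

Definition prep (s t : int) (st : s <= t) (W : {vspace grpAlg C (G s)})
    (g : G s) : 'End(subvs_of (pspace st W)) :=
  restr_end (pspace st W) (lreg C (pg_map G st g)).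

Definition fourier (theta : forall t : int, G t -> C) (s : int)
    (W : {vspace grpAlg C (G s)}) : 'End(subvs_of W) :=
  fourier_at (theta s) (rep W).

Definition pfourier (theta : forall t : int, G t -> C) (s t : int)
    (st : s <= t) (W : {vspace grpAlg C (G s)}) :
    'End(subvs_of (pspace st W)) :=
  fourier_at (theta s) (prep st W).

Definition push_basis (s t : int) (st : s <= t) (W : {vspace grpAlg C (G s)})
    (n : nat) (B : n.-tuple (subvs_of W)) :
    n.-tuple (subvs_of (pspace st W)) :=
  [tuple vsproj (pspace st W) (alg_ext C (pg_map G st) (vsval (tnth B i)))
     | i < n].

Lemma pspace_stable (s t : int) (st : s <= t) (W : {vspace grpAlg C (G s)})
    (g : G s) :
  lreg_stable W ->
  (lreg C (pg_map G st g) @: pspace st W <= pspace st W)%VS.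
Proof.
move=> Wst; apply/subvP => _ /memv_imgP[_ /memv_imgP[w wW ->] ->].
suff -> : lreg C (pg_map G st g) (alg_ext C (pg_map G st) w) =
          alg_ext C (pg_map G st) (lreg C g w).
  by apply: memv_img; apply: (subvP (Wst g)); apply: memv_img.
apply/ffunP => k; rewrite lregE !alg_extE [RHS](reindex_inj (mulgI g)) /=.
apply: eq_big => [h|h _]; last by rewrite lregE mulKg.
by rewrite gmulfM -(inj_eq (mulgI (pg_map G st g))) mulKVg.
Qed.

End Persistent.

Section MatrixNorms.
Variable R : realType.
Local Notation C := R[i].

(* The norm of an endomorphism is that of its matrix in a basis B: for a
   unitarily invariant N it does not depend on the choice of an orthonormal B. *)
Definition Spec (N : forall n : nat, 'M[C]_n -> R) (G : persistenceGroup)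
    (theta : forall t : int, G t -> C) (s : int) (W : {vspace grpAlg C (G s)})
    (n : nat) (B : n.-tuple (subvs_of W)) : R :=
  N n (mx_end B (fourier theta W)).

Definition pSpec (N : forall n : nat, 'M[C]_n -> R) (G : persistenceGroup)
    (theta : forall t : int, G t -> C) (s t : int) (st : s <= t)
    (W : {vspace grpAlg C (G s)}) (n : nat)
    (B : n.-tuple (subvs_of (pspace st W))) : R :=
  N n (mx_end B (pfourier theta st W)).

Definition matrix_norm (N : forall n : nat, 'M[C]_n -> R) : Prop :=
  forall n : nat,
    [/\ forall A : 'M[C]_n, N n A = 0 -> A = 0,
        forall (a : C) (A : 'M[C]_n), N n (a *: A) = complex.Re `|a| * N n A &
        forall A B : 'M[C]_n, N n (A + B) <= N n A + N n B].

(* Invariance under unitary change of basis: exactly what makes N n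
   well defined on the endomorphisms of an n-dimensional Hilbert space. *)
Definition unitarily_invariant (N : forall n : nat, 'M[C]_n -> R) : Prop :=
  forall (n : nat) (U A : 'M[C]_n),
    U \is unitarymx -> N n (U *m A *m U^t*) = N n A.

Definition hs_norm (n : nat) (A : 'M[C]_n) : R :=
  Num.sqrt (complex.Re (\tr (A^t* *m A))).

Lemma hs_norm_invariant : unitarily_invariant hs_norm.
Proof.
move=> n U A Uu; congr (Num.sqrt (complex.Re _)).
have UU : U^t* *m U = 1%:M.
  by rewrite -invmx_unitary // mulVmx // unitarymx_unit.
rewrite !trmx_mul !map_mxM /= trmxCK -!mulmxA (mulmxA (U^t*) U) UU mul1mx.
by rewrite mxtrace_mulC -!mulmxA UU mulmx1.
Qed.

Lemma hs_normE n (A : 'M[C]_n) :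
  (hs_norm A)%:C%C = sqrtC (dotmx (mxvec A) (mxvec A)).
Proof.
have -> : dotmx (mxvec A) (mxvec A) = \tr (A^t* *m A).
  rewrite dotmxE mxE (reindex _ (curry_mxvec_bij _ _)) /= mxtrace_mulC.
  rewrite /mxtrace; under [RHS]eq_bigr do rewrite mxE.
  rewrite pair_bigA /=; apply: eq_bigr => -[i j] _ /=.
  by rewrite !mxE !mxvecE.
rewrite /hs_norm; set x := \tr _.
have x0 : 0 <= x.
  rewrite /x /mxtrace; apply: sumr_ge0 => i _; rewrite mxE; apply: sumr_ge0.
  by move=> j _; rewrite !mxE mulrC mul_conjC_ge0.
have [r r0 ->] : exists2 r : R, 0 <= r & x = r%:C%C.
  clearbody x; case: x x0 => a b; rewrite lecE /= => /andP[/eqP-> a0].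
  by exists a.
rewrite /=; apply/eqP; rewrite -(@eqrXn2 _ 2) ?sqrtC_ge0 ?lecR ?sqrtr_ge0 //.
by rewrite sqrtCK -rmorphXn /= sqr_sqrtr.
Qed.

Lemma hs_norm_matrix_norm : matrix_norm hs_norm.
Proof.
move=> n; split=> [A|a A|A B].
- move/(congr1 (real_complex R)); rewrite hs_normE rmorph0 => /eqP.
  rewrite sqrtC_eq0 dnorm_eq0 => /eqP /(congr1 vec_mx).
  by rewrite mxvecK linear0.
- apply: (@complexI R); rewrite [RHS](rmorphM (real_complex R)).
  rewrite hs_normE linearZ /= dnormZ rootCMl ?exprn_ge0 // sqrCK //.
  by congr (_ * _); rewrite hs_normE.
- rewrite -lecR rmorphD /= !hs_normE linearD /=; exact: triangle_lerif.
Qed.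

End MatrixNorms.

(* Main.v *)
Require Import Defs.
From HB Require Import structures.
From mathcomp Require Import all_boot all_order all_algebra all_fingroup.
From mathcomp Require Import spectral sesquilinear reals complex.

Set Implicit Arguments.
Unset Strict Implicit.
Unset Printing Implicit Defensive.

Import Order.TTheory GRing.Theory Num.Theory.

Local Open Scope ring_scope.

(** The linear extension [f] of a homomorphism [phi] intertwines left
    translations, so the part of an irreducible [W] that [f] kills is
    a subrepresentation of [W]; since [f(W)] is nonzero it is zero, and [f]
    maps [W] isomorphically onto [f(W)].  Hence the Fourier transforms on [W]
    and on [f(W)] are conjugate, and they have literally the same matrix in
    a basis of [W] and in its image ([basis_push_basis],
    [mx_end_push_basis]).

    For a unitarily invariant norm the two matrices are taken in unrelated
    orthonormal bases, so one needs in addition that [f] is a multiple of an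
    isometry on [W].  Schur's lemma would give this, but there is a direct
    reason.  If [phi k = 1] then [f] does not distinguish [w] from its
    translate by [k]; as [f] is injective on [W], every [w] in [W] is invariant
    under the kernel [K] of [phi].  Thus [f w] takes at [phi h] the value
    [#|K| w h], and summing over fibres gives [<f u, f v> = #|K| <u, v>]
    ([cinner_alg_ext]).  The change of basis from the image of one orthonormal
    basis to another orthonormal basis is therefore [sqrt #|K|] times a unitary
    matrix, and conjugation does not see the scalar
    ([mx_end_unitary_conj]). *)

(** * The Hermitian form on the group algebra *)

Section InnerProduct.
Variables (C : numClosedFieldType) (gT : finGroupType).
Implicit Types u v : grpAlg C gT.

Lemma cinner_conj u v : (cinner u v)^* = cinner v u.
Proof.
rewrite /cinner rmorph_sum /=; apply: eq_bigr => x _.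
by rewrite rmorphM /= conjCK mulrC.
Qed.

Lemma cinner_suml (I : finType) (a : I -> C) (u : I -> grpAlg C gT) v :
  cinner (\sum_i a i *: u i) v = \sum_i a i * cinner (u i) v.
Proof.
rewrite /cinner; under [RHS]eq_bigr do rewrite mulr_sumr.
rewrite exchange_big /=; apply: eq_bigr => x _.
rewrite sum_ffunE mulr_suml; apply: eq_bigr => i _.
by rewrite ffunE -mulrA.
Qed.

Lemma cinner_sumr (I : finType) (a : I -> C) u (v : I -> grpAlg C gT) :
  cinner u (\sum_i a i *: v i) = \sum_i (a i)^* * cinner u (v i).
Proof.
rewrite -cinner_conj cinner_suml rmorph_sum /=; apply: eq_bigr => i _.
by rewrite rmorphM /= cinner_conj.
Qed.

End InnerProduct.

(** * Extending a homomorphism to an irreducible subrepresentation *)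

Section AlgebraExtension.
Variables (C : numClosedFieldType) (gT hT : finGroupType).
Variable phi : {multiplicative gT -> hT}.
Implicit Types w : grpAlg C gT.

Lemma alg_ext_lreg g w :
  alg_ext C phi (lreg C g w) = lreg C (phi g) (alg_ext C phi w).
Proof.
apply/ffunP => k; rewrite lregE !alg_extE [LHS](reindex_inj (mulgI g)) /=.
apply: eq_big => [h|h _]; last by rewrite lregE mulKg.
by rewrite gmulfM -(inj_eq (mulgI (phi g)^-1%g)) mulKg.
Qed.

Variable W : {vspace grpAlg C gT}.
Hypothesis irrW : irreducible_subrep W.
Hypothesis imW_neq0 : (alg_ext C phi @: W)%VS != 0%VS.

(** The kernel of the extension, cut down to [W], is a subrepresentation; it
    is not all of [W] because the image of [W] is nonzero. *)
Lemma alg_ext_ker0 : (W :&: lker (alg_ext C phi))%VS = 0%VS.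
Proof.
case: irrW => _ stW minW.
have [g|//|WK] := minW _ (capvSl W (lker (alg_ext C phi))).
  apply/subvP => _ /memv_imgP[w + ->]; rewrite !memv_cap !memv_ker.
  move=> /andP[wW /eqP fw0]; rewrite alg_ext_lreg fw0 linear0 eqxx andbT.
  by apply: (subvP (stW g)); apply: memv_img.
case/eqP: imW_neq0; apply/eqP; rewrite -lkerE -[W]WK; exact: capvSr.
Qed.

Lemma alg_ext_inj : {in W &, injective (alg_ext C phi)}.
Proof.
move=> u v uW vW fuv; apply/eqP; rewrite -subr_eq0 -memv0 -alg_ext_ker0.
by rewrite memv_cap memvB // memv_ker linearB /= fuv subrr.
Qed.

(** A translation by [k] in the kernel of [phi] becomes trivial after the
    extension, which is injective on [W]. *)
Lemma lreg_ker w k : w \in W -> phi k = 1%g -> lreg C k w = w.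
Proof.
move=> wW phik; case: irrW => _ stW _; apply: alg_ext_inj => //.
  by apply: (subvP (stW k)); apply: memv_img.
by rewrite alg_ext_lreg phik; apply/ffunP => x; rewrite lregE invg1 mul1g.
Qed.

Lemma alg_ext_fiber w h : w \in W ->
  alg_ext C phi w (phi h) = w h *+ #|[pred k | phi k == 1%g]|.
Proof.
move=> wW; rewrite alg_extE (reindex_inj (mulIg h)) /= -sumr_const.
apply: eq_big => [k|k /eqP phikh].
  by rewrite inE gmulfM -(inj_eq (mulIg (phi h)^-1%g)) mulgK mulgV.
have phik : phi k^-1%g = 1%g.
  have phi_h : phi (k^-1 * (k * h))%g = phi h by rewrite mulKg.
  by move: phi_h; rewrite gmulfM phikh => /(canRL (mulgK _)); rewrite mulgV.
by rewrite -{2}(lreg_ker wW phik) lregE invgK.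
Qed.

(** Elements of [W] are constant on the fibres of [phi], all of which have the
    size of its kernel. *)
Lemma cinner_alg_ext u v : u \in W -> v \in W ->
  cinner (alg_ext C phi u) (alg_ext C phi v) =
  #|[pred k | phi k == 1%g]|%:R * cinner u v.
Proof.
move=> uW vW; rewrite /cinner mulr_sumr.
rewrite [RHS](partition_big phi predT) //=; apply: eq_bigr => y _.
rewrite alg_extE mulr_suml; apply: eq_bigr => h /eqP <-.
by rewrite alg_ext_fiber // rmorphMn /= mulrnAr mulr_natl.
Qed.

End AlgebraExtension.

(** * Change of basis *)

Section MatrixOfEndomorphism.
Variable C : numClosedFieldType.

Definition basis_change (V : vectType C) (n : nat) (X Y : n.-tuple V) :
    'M[C]_n :=
  \matrix_(i < n, j < n) coord Y i (tnth X j).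

Lemma basis_sum (V : vectType C) n (X : n.-tuple V) v :
  basis_of fullv X -> v = \sum_i coord X i v *: tnth X i.
Proof.
move=> Xb; rewrite {1}(coord_basis Xb (memvf v)).
by apply: eq_bigr => i _; rewrite (tnth_nth 0).
Qed.

Lemma vsval_basis_sum (V : vectType C) (W : {vspace V}) n
    (X : n.-tuple (subvs_of W)) v :
  basis_of fullv X -> vsval v = \sum_i coord X i v *: vsval (tnth X i).
Proof.
move=> Xb; rewrite {1}(basis_sum v Xb) linear_sum.
by apply: eq_bigr => i _; rewrite linearZ.
Qed.

Lemma coord_sum_basis (V : vectType C) n (X : n.-tuple V) (a : 'I_n -> C) i :
  basis_of fullv X -> coord X i (\sum_j a j *: tnth X j) = a i.
Proof.
move=> Xb; rewrite -[RHS](coord_sum_free a i (basis_free Xb)).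
by congr (coord X i _); apply: eq_bigr => j _; rewrite (tnth_nth 0).
Qed.

Lemma mx_end_basis_change (V : vectType C) n (X Y : n.-tuple V) (A : 'End(V)) :
  basis_of fullv X -> basis_of fullv Y ->
  basis_change X Y *m mx_end X A = mx_end Y A *m basis_change X Y.
Proof.
move=> Xb Yb; apply/matrixP => i j; rewrite !mxE.
(* Both sides are the i-th coordinate in Y of the image of X_j under A. *)
transitivity (coord Y i (A (tnth X j))).
  rewrite (basis_sum (A (tnth X j)) Xb) linear_sum /=.
  by apply: eq_bigr => k _; rewrite !mxE linearZ mulrC.
rewrite (basis_sum (tnth X j) Yb) !linear_sum /=.
by apply: eq_bigr => k _; rewrite !mxE !linearZ mulrC.
Qed.

(** Relative to an orthonormal [Y], the columns of the change of basis have
    the Gram matrix of [X], which is scalar; rescaling gives a unitary. *)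
Lemma mx_end_unitary_conj (gT : finGroupType) (W : {vspace grpAlg C gT}) n
    (X Y : n.-tuple (subvs_of W)) (A : 'End(subvs_of W)) (c : C) :
    0 < c -> basis_of fullv X -> orthonormal_basis Y ->
    (forall i j, cinner (vsval (tnth X i)) (vsval (tnth X j)) =
                 c * (i == j)%:R) ->
  exists2 U : 'M[C]_n, U \is unitarymx &
    mx_end Y A = U *m mx_end X A *m U^t*%sesqui.
Proof.
move=> c_gt0 Xb [Yb Yon] Xgram.
set P := basis_change X Y.
have gramP : P^t*%sesqui *m P = c%:M.
  apply/matrixP => i j; rewrite !mxE eq_sym -mulr_natr -Xgram.
  rewrite (vsval_basis_sum (tnth X i) Yb) (vsval_basis_sum (tnth X j) Yb).
  rewrite cinner_suml; apply: eq_bigr => k _; rewrite cinner_sumr.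
  rewrite (bigD1 k) //= big1 ?addr0 => [|l lk].
    by rewrite Yon eqxx mulr1 !mxE mulrC.
  by rewrite Yon eq_sym (negPf lk) mulr0.
pose r := sqrtC c; have r_gt0 : 0 < r by rewrite sqrtC_gt0.
have rr : r^-1 * r^-1 * c = 1.
  by rewrite -[c]sqrtCK -/r expr2 mulrACA mulVf ?mulr1 ?gt_eqF.
pose U := r^-1 *: P.
have UtE : U^t*%sesqui = r^-1 *: P^t*%sesqui.
  apply/matrixP => i j; rewrite !mxE rmorphM /=; congr (_ * _).
  by apply: conj_Creal; rewrite realV gtr0_real.
have UU : U^t*%sesqui *m U = 1%:M.
  by rewrite UtE -scalemxAl -scalemxAr scalerA gramP scale_scalar_mx rr.
have UU' := mulmx1C UU; exists U; first exact/unitarymxP.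
by rewrite -scalemxAl mx_end_basis_change // scalemxAr -mulmxA UU' mulmx1.
Qed.

End MatrixOfEndomorphism.

(** * The isomorphism from W onto its image *)

Section Push.
Variables (C : numClosedFieldType) (G : persistenceGroup).
Variables (s t : int) (st : s <= t) (W : {vspace grpAlg C (G s)}).

Definition push : 'Hom(subvs_of W, subvs_of (pspace st W)) :=
  linfun (vsproj (pspace st W) \o alg_ext C (pg_map G st) \o @vsval _ _ W).

Lemma pushE w : vsval (push w) = alg_ext C (pg_map G st) (vsval w).
Proof. by rewrite lfunE /= vsprojK // memv_img // subvsP. Qed.

Lemma tnth_push_basis n (B : n.-tuple (subvs_of W)) i :
  tnth (push_basis st B) i = push (tnth B i).
Proof. by rewrite tnth_mktuple lfunE. Qed.

Lemma push_basisE n (B : n.-tuple (subvs_of W)) :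
  push_basis st B = [tuple of map push B].
Proof. by apply: eq_from_tnth => i; rewrite tnth_push_basis tnth_map. Qed.

Lemma vsval_fourier (theta : forall t : int, G t -> C) w : lreg_stable W ->
  vsval (fourier theta W w) =
  \sum_g theta s g *: lreg C g^-1%g (vsval w).
Proof.
move=> stW; rewrite sum_lfunE linear_sum; apply: eq_bigr => g _.
by rewrite scale_lfunE linearZ /= restr_endE.
Qed.

Lemma vsval_pfourier (theta : forall t : int, G t -> C) w : lreg_stable W ->
  vsval (pfourier theta st W w) =
  \sum_g theta s g *: lreg C (pg_map G st g^-1%g) (vsval w).
Proof.
move=> stW; rewrite sum_lfunE linear_sum; apply: eq_bigr => g _.
by rewrite scale_lfunE linearZ /= restr_endE ?pspace_stable.
Qed.

Lemma push_fourier (theta : forall t : int, G t -> C) w : lreg_stable W ->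
  push (fourier theta W w) = pfourier theta st W (push w).
Proof.
move=> stW; apply: val_inj; rewrite /= pushE vsval_fourier // vsval_pfourier //.
rewrite linear_sum; apply: eq_bigr => g _.
by rewrite linearZ /= alg_ext_lreg pushE.
Qed.

Hypotheses (irrW : irreducible_subrep W) (imW_neq0 : pspace st W != 0%VS).

Lemma lker_push : lker push == 0%VS.
Proof.
apply/lker0P => u v /(congr1 (@vsval _ _ _)); rewrite !pushE => fuv.
by apply: val_inj; apply: (alg_ext_inj irrW imW_neq0); rewrite ?subvsP.
Qed.

Lemma limg_push : limg push = fullv.
Proof.
apply: subv_anti; rewrite subvf; apply/subvP => v _.
have /memv_imgP[w wW vE] := subvsP v.
suff -> : v = push (vsproj W w) by apply: memv_img; exact: memvf.
by apply: val_inj; rewrite /= pushE vsprojK.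
Qed.

Lemma basis_push_basis n (B : n.-tuple (subvs_of W)) :
  basis_of fullv B -> basis_of fullv (push_basis st B).
Proof.
move=> Bb; rewrite push_basisE -limg_push; apply: limg_basis_of => //.
by rewrite capfv; exact/eqP/lker_push.
Qed.

(** The push-forward conjugates one Fourier transform into the other, so it
    carries the coordinates in a basis to those in its image. *)
Lemma mx_end_push_basis (theta : forall t : int, G t -> C) n
    (B : n.-tuple (subvs_of W)) :
  basis_of fullv B ->
  mx_end (push_basis st B) (pfourier theta st W) = mx_end B (fourier theta W).
Proof.
case: irrW => _ stW _ Bb; apply/matrixP => i j; rewrite !mxE tnth_push_basis.
rewrite -push_fourier // {1}(basis_sum (fourier theta W (tnth B j)) Bb).
rewrite linear_sum /=.
under [X in coord _ _ X]eq_bigr => k _ do rewrite linearZ /= -tnth_push_basis.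
by rewrite coord_sum_basis //; exact: basis_push_basis.
Qed.

End Push.

(** * Equality of the spectra *)

Theorem theorem3p2p7 (R : realType) (G : persistenceGroup)
    (theta : forall t : int, G t -> R[i]) (htheta : persistent_function theta)
    (s t : int) (st : s <= t)
    (W : {vspace grpAlg R[i] (G s)}) (hW : irreducible_subrep W)
    (hst : pspace st W != 0%VS) :
  (forall N : (forall n : nat, 'M[R[i]]_n -> R),
     matrix_norm N -> unitarily_invariant N ->
     forall (n m : nat) (B : n.-tuple (subvs_of W))
            (B' : m.-tuple (subvs_of (pspace st W))),
       orthonormal_basis B -> orthonormal_basis B' ->
       pSpec N theta B' = Spec N theta B) /\
  (forall N : (forall n : nat, 'M[R[i]]_n -> R),
     matrix_norm N ->
     forall (n : nat) (B : n.-tuple (subvs_of W)),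
       basis_of fullv B ->
       basis_of fullv (push_basis st B) /\
       pSpec N theta (push_basis st B) = Spec N theta B).
Proof.
split=> N _; last first.
  move=> n B Bb; split; first exact: basis_push_basis.
  by rewrite /pSpec /Spec mx_end_push_basis.
move=> Ninv n m B B' [Bb Bon] B'on.
have PBb := basis_push_basis hW hst Bb.
have nm : m = n by rewrite -(size_basis PBb) (size_basis (proj1 B'on)).
move: B' B'on; rewrite nm => B' B'on.
pose c : R[i] := #|[pred k | pg_map G st k == 1%g]|%:R.
have c_gt0 : 0 < c.
  (* The kernel contains 1. *)
  rewrite ltr0n; apply/card_gt0P; exists 1%g; rewrite inE.
  by apply/eqP/(mulgI (pg_map G st 1%g)); rewrite -gmulfM !mulg1.
have [|U Uu mxE'] := mx_end_unitary_conj (pfourier theta st W) c_gt0 PBb B'on.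
  move=> i j; rewrite !tnth_push_basis !pushE.
  by rewrite (cinner_alg_ext hW hst) ?subvsP // Bon.
by rewrite /pSpec /Spec mxE' Ninv // mx_end_push_basis.
Qed.
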